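(* Let $\alpha,\beta$ be Martin-Löf random left-c.e. reals. Define $\mathcal{D}(\alpha,\beta)=\inf\{q\in\mathbb{Q}^+ : q\alpha-\beta \text{ is a left-c.e. real}\}$ and $\mathcal{D}^{\ast}(\alpha,\beta)=\sup\{q\in\mathbb{Q}^+ : q\alpha-\beta \text{ is a right-c.e. real}\}$. Then $\mathcal{D}(\alpha,\beta)=\mathcal{D}^{\ast}(\alpha,\beta)$.
   Context: A real is left-c.e. if it is the limit of a computable increasing sequence of rationals (equivalently its left Dedekind cut is c.e.), and right-c.e. if it is the limit of a computable decreasing sequence of rationals. $\mathbb{Q}^+$ denotes the positive rationals. A real is Martin-Löf random if (the binary expansion of its fractional part) is Martin-Löf random. *)

(* Defs.v *)
From Stdlib Require Import Reals Lra Lia List.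
From Coquelicot Require Import Coquelicot.
Import ListNotations.
Open Scope R_scope.

(* A model of computation: unary partial recursive functions on nat,   *)
(* using Cantor pairing (complete for partial recursive functions).    *)

(* Cantor pairing: enumerates (0,0),(1,0),(0,1),(2,0),(1,1),(0,2),... *)
Fixpoint unpair (n : nat) : nat * nat :=
  match n with
  | O => (O, O)
  | S n' => let (x, y) := unpair n' in
            match x with
            | O => (S y, O)
            | S x' => (x', S y)
            end
  end.

Definition pair (x y : nat) : nat :=
  ((x + y) * (x + y + 1) / 2 + y)%nat.

Inductive code : Type :=
| cZero : code
| cSucc : code
| cFst  : code
| cSnd  : code
| cComp : code -> code -> code
| cPair : code -> code -> code
| cPrec : code -> code -> code      (* h <a,0> = f a ; h <a,n+1> = g <a,<n,h <a,n>>> *)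
| cMin  : code -> code.             (* x |-> least n with f <x,n> = 0 *)

(* Fuel-indexed evaluator; [Some v] is always the true value. *)
Fixpoint eval (fuel : nat) (c : code) (x : nat) {struct fuel} : option nat :=
  match fuel with
  | O => None
  | S k =>
    match c with
    | cZero => Some O
    | cSucc => Some (S x)
    | cFst => Some (fst (unpair x))
    | cSnd => Some (snd (unpair x))
    | cComp f g =>
        match eval k g x with Some y => eval k f y | None => None end
    | cPair f g =>
        match eval k f x, eval k g x with
        | Some a, Some b => Some (pair a b)
        | _, _ => None
        end
    | cPrec f g =>
        let (a, n) := unpair x in
        match n with
        | O => eval k f a
        | S m =>
            match eval k (cPrec f g) (pair a m) with
            | Some h => eval k g (pair a (pair m h))
            | None => None
            end
        end
    | cMin f =>
        (fix search (fu : nat) (n : nat) {struct fu} : option nat :=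
           match fu with
           | O => None
           | S fu' =>
               match eval k f (pair x n) with
               | Some O => Some n
               | Some (S _) => search fu' (S n)
               | None => None
               end
           end) k O
    end
  end.

Definition computable (f : nat -> nat) : Prop :=
  exists c : code, forall x : nat, exists fuel : nat, eval fuel c x = Some (f x).

(* Decoding naturals as rationals: <a,<b,c>> |-> (a - b)/(c+1). Surjective onto Q. *)
Definition qdecode (n : nat) : R :=
  let (a, r) := unpair n in
  let (b, c) := unpair r in
  (INR a - INR b) / INR (S c).

Definition left_ce (x : R) : Prop :=
  exists f : nat -> nat, computable f /\
    (forall n, qdecode (f n) <= qdecode (f (S n))) /\
    Un_cv (fun n => qdecode (f n)) x.

Definition right_ce (x : R) : Prop :=
  exists f : nat -> nat, computable f /\
    (forall n, qdecode (f (S n)) <= qdecode (f n)) /\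
    Un_cv (fun n => qdecode (f n)) x.

Definition bstring := list bool.

(* Decoding naturals as binary strings: <len, m> |-> the len low bits of m. Surjective. *)
Fixpoint bits_of (len m : nat) : bstring :=
  match len with
  | O => []
  | S l => Nat.odd m :: bits_of l (Nat.div2 m)
  end.

Definition sdecode (n : nat) : bstring := let (l, m) := unpair n in bits_of l m.

Definition is_prefix (s t : bstring) : Prop := exists u, t = s ++ u.

Definition prefix_free (S : list bstring) : Prop :=
  NoDup S /\ forall s t, In s S -> In t S -> s <> t -> ~ is_prefix s t.

Definition weight (S : list bstring) : R :=
  fold_right (fun s acc => (/ 2) ^ length s + acc) 0 S.

Fixpoint dyadic (s : bstring) : R :=
  match s with
  | [] => 0
  | b :: s' => (if b then / 2 else 0) + / 2 * dyadic s'
  end.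

(* y in [0,1) lies in the cylinder [s] (its binary expansion extends s). *)
Definition in_cyl (s : bstring) (y : R) : Prop :=
  dyadic s <= y < dyadic s + (/ 2) ^ length s.

(* A Martin-Löf test, given by a computable enumeration [g]:
   g k = 0 enumerates nothing, g k = S <n, code s> enumerates s into U_n.
   The measure of the open set [U_n] (= sup of weights of finite prefix-free
   subsets of U_n) is required to be at most 2^{-n}. *)
Definition in_test (g : nat -> nat) (n : nat) (s : bstring) : Prop :=
  exists k m, g k = S m /\ fst (unpair m) = n /\ sdecode (snd (unpair m)) = s.

Definition ML_test (g : nat -> nat) : Prop :=
  computable g /\
  forall n (S : list bstring),
    prefix_free S -> (forall s, In s S -> in_test g n s) -> weight S <= (/ 2) ^ n.

Definition ML_random01 (y : R) : Prop :=
  ~ exists g, ML_test g /\ forall n, exists s, in_test g n s /\ in_cyl s y.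

Definition ML_random (x : R) : Prop := ML_random01 (frac_part x).

Definition pos_rat (q : R) : Prop :=
  0 < q /\ exists a b : nat, q = INR a / INR (S b).

Definition Dsolovay (alpha beta : R) : Rbar :=
  Glb_Rbar (fun q => pos_rat q /\ left_ce (q * alpha - beta)).

Definition Dstar (alpha beta : R) : Rbar :=
  Lub_Rbar (fun q => pos_rat q /\ right_ce (q * alpha - beta)).

(* Main.v *)
(* Fix computable increasing approximations of alpha and beta. The infimum is at least the supremum
   because two values in the wrong order would make a positive rational multiple of alpha, hence
   alpha itself, right-c.e. as well as left-c.e., and so computable. Conversely, for rationals p < q
   either q alpha - beta is left-c.e. or p alpha - beta is right-c.e.; otherwise the approximations
   of these two reals are infinitely often above, respectively below, their limits, and each such
   oscillation traps alpha in an interval whose length is paid for by an increase of the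
   approximation of beta, so that alpha is not random. Finally the set defining the supremum is not
   empty, because alpha is Solovay reducible to the random real beta (Kucera-Slaman). *)
Require Import Defs.
From Stdlib Require Import Reals Lra Lia List Classical Wf_nat.
From Coquelicot Require Import Coquelicot.
Import ListNotations.

(** * Closure properties of computable functions *)

Open Scope nat_scope.

(** The use of two slopes is what makes the trap work. If [x], [y] approximate alpha and beta, then
    [q x - y] and [p x - y] differ by [(q - p) x], which increases to [q - p] times alpha. Freeze
    the first at an index [s] where it exceeds its limit and let the second run on: the difference
    divided by [q - p] starts at x_s, not above alpha, and later exceeds alpha, so some step crosses
    alpha. Neither [s] nor the crossing step can be found effectively. The test need not know which
    of its intervals are hits, however: it computes one interval at every step, with a local maximum
    of the first approximation in place of the unknown frozen value. The total length of these
    intervals is finite but not small, so infinitely many hits become a Martin-Löf test by counting: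
    the points covered at least 2^m times have measure at most 2^-m times the total length. The same
    counting test with threshold 1 serves the other two uses of randomness. *)

Lemma triangle_S (n : nat) : S n * (S n + 1) / 2 = n * (n + 1) / 2 + S n.
Proof.
  replace (S n * (S n + 1)) with (n * (n + 1) + S n * 2) by ring.
  now rewrite Nat.div_add.
Qed.

Lemma pair_S_0 (y : nat) : pair (S y) 0 = S (pair 0 y).
Proof. unfold pair; rewrite !Nat.add_0_r, Nat.add_0_l, triangle_S; lia. Qed.

Lemma pair_S (x y : nat) : pair x (S y) = S (pair (S x) y).
Proof. unfold pair; replace (x + S y) with (S x + y) by lia; lia. Qed.

Lemma pair_unpair (n : nat) : pair (fst (unpair n)) (snd (unpair n)) = n.
Proof.
  induction n as [|n IH]; [reflexivity|].
  simpl; destruct (unpair n) as [[|x] y]; simpl fst in *; simpl snd in *; subst n.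
  - apply pair_S_0.
  - apply pair_S.
Qed.

(** The induction follows the enumeration: the outer one runs over the antidiagonals [x + y], the
    inner one along a single antidiagonal. *)
Lemma unpair_pair (x y : nat) : unpair (pair x y) = (x, y).
Proof.
  remember (x + y) as d eqn:Hd; revert x y Hd.
  induction d as [|d IHd]; intros x y Hd.
  - now replace x with 0 by lia; replace y with 0 by lia.
  - revert x Hd; induction y as [|y IHy]; intros x Hd.
    + replace x with (S d) by lia.
      rewrite pair_S_0; simpl; now rewrite IHd.
    + rewrite pair_S; simpl; now rewrite IHy by lia.
Qed.

(** Allows computations found with separate amounts of fuel to be run under a common one. *)
Lemma eval_S (k : nat) : forall c x v, eval k c x = Some v -> eval (S k) c x = Some v.
Proof.
  induction k as [|k IH]; [discriminate|].
  intros c x v; destruct c as [| | | |f g|f g|f g|f]; try exact (fun H => H).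
  - change (match eval k g x with Some y => eval k f y | None => None end = Some v ->
      match eval (S k) g x with Some y => eval (S k) f y | None => None end = Some v).
    destruct (eval k g x) as [y|] eqn:E; [|discriminate].
    rewrite (IH _ _ _ E); apply IH.
  - change (match eval k f x, eval k g x with Some a, Some b => Some (pair a b) | _, _ => None end
        = Some v ->
      match eval (S k) f x, eval (S k) g x with Some a, Some b => Some (pair a b) | _, _ => None end
        = Some v).
    destruct (eval k f x) eqn:E1; [|discriminate].
    destruct (eval k g x) eqn:E2; [|discriminate].
    now rewrite (IH _ _ _ E1), (IH _ _ _ E2).
  - change (
      (let (a, n) := unpair x in match n with O => eval k f a | S m =>
         match eval k (cPrec f g) (pair a m) with
         | Some h => eval k g (pair a (pair m h)) | None => None end end) = Some v ->
      (let (a, n) := unpair x in match n with O => eval (S k) f a | S m =>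
         match eval (S k) (cPrec f g) (pair a m) with
         | Some h => eval (S k) g (pair a (pair m h)) | None => None end end) = Some v).
    destruct (unpair x) as [a [|m]]; [apply IH|].
    destruct (eval k (cPrec f g) (pair a m)) as [h|] eqn:E; [|discriminate].
    rewrite (IH _ _ _ E); apply IH.
  - set (search j := fix search (fu n : nat) {struct fu} : option nat :=
           match fu with
           | O => None
           | S fu' => match eval j f (pair x n) with
               | Some O => Some n | Some (S _) => search fu' (S n) | None => None end
           end).
    change (search k k 0 = Some v -> search (S k) (S k) 0 = Some v).
    (* In [cMin] the same fuel bounds the search and the evaluations. The two bounds are separated,
       and the induction is on the search bound alone. *)
    assert (H : forall fu n, search k fu n = Some v -> search (S k) (S fu) n = Some v).
    { induction fu as [|fu IHfu]; [discriminate|]; intros n.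
      change (match eval k f (pair x n) with
        | Some O => Some n | Some (S _) => search k fu (S n) | None => None end = Some v ->
        match eval (S k) f (pair x n) with
        | Some O => Some n | Some (S _) => search (S k) (S fu) (S n) | None => None end = Some v).
      destruct (eval k f (pair x n)) as [[|w]|] eqn:E; try discriminate;
        rewrite (IH _ _ _ E); [easy|apply IHfu]. }
    apply H.
Qed.

Lemma eval_le (k j : nat) (c : code) (x v : nat) :
  k <= j -> eval k c x = Some v -> eval j c x = Some v.
Proof. induction 1; auto using eval_S. Qed.

Lemma computable_ext (f g : nat -> nat) :
  (forall x, f x = g x) -> computable f -> computable g.
Proof.
  intros E [c H]; exists c; intros x; destruct (H x) as [k Hk].
  exists k; now rewrite <- E.
Qed.

Lemma computable_comp (f g : nat -> nat) :
  computable f -> computable g -> computable (fun x => f (g x)).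
Proof.
  intros [cf Hf] [cg Hg]; exists (cComp cf cg); intros x.
  destruct (Hg x) as [j Hj], (Hf (g x)) as [k Hk].
  exists (S (j + k)); simpl.
  rewrite (eval_le j (j + k) _ _ _ ltac:(lia) Hj).
  apply (eval_le k); [lia|exact Hk].
Qed.

Lemma computable_pair (f g : nat -> nat) :
  computable f -> computable g -> computable (fun x => pair (f x) (g x)).
Proof.
  intros [cf Hf] [cg Hg]; exists (cPair cf cg); intros x.
  destruct (Hg x) as [j Hj], (Hf x) as [k Hk].
  exists (S (j + k)); simpl.
  now rewrite (eval_le j (j + k) _ _ _ ltac:(lia) Hj), (eval_le k (j + k) _ _ _ ltac:(lia) Hk).
Qed.

Definition pi1 (x : nat) : nat := fst (unpair x).
Definition pi2 (x : nat) : nat := snd (unpair x).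

Lemma pi1_pair (x y : nat) : pi1 (pair x y) = x.
Proof. unfold pi1; now rewrite unpair_pair. Qed.

Lemma pi2_pair (x y : nat) : pi2 (pair x y) = y.
Proof. unfold pi2; now rewrite unpair_pair. Qed.

Lemma computable_pi1 (f : nat -> nat) : computable f -> computable (fun x => pi1 (f x)).
Proof. apply (computable_comp pi1); exists cFst; intros x; now exists 1. Qed.

Lemma computable_pi2 (f : nat -> nat) : computable f -> computable (fun x => pi2 (f x)).
Proof. apply (computable_comp pi2); exists cSnd; intros x; now exists 1. Qed.

Lemma computable_S (f : nat -> nat) : computable f -> computable (fun x => S (f x)).
Proof. apply (computable_comp S); exists cSucc; intros x; now exists 1. Qed.

(** There is no code for the identity; it is recovered by pairing the two projections. *)
Lemma computable_id : computable (fun x => x).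
Proof.
  apply (computable_ext (fun x => pair (pi1 x) (pi2 x)) _ pair_unpair).
  apply computable_pair; [exists cFst|exists cSnd]; intros x; now exists 1.
Qed.

Lemma computable_const (n : nat) : computable (fun _ => n).
Proof.
  induction n as [|n IH]; [exists cZero; intros x; now exists 1|].
  now apply computable_S.
Qed.

Definition computable2 (f : nat -> nat -> nat) : Prop :=
  computable (fun z => f (pi1 z) (pi2 z)).

Lemma computable2_app (f : nat -> nat -> nat) (g h : nat -> nat) :
  computable2 f -> computable g -> computable h -> computable (fun x => f (g x) (h x)).
Proof.
  intros Hf Hg Hh.
  apply (computable_ext (fun x => (fun z => f (pi1 z) (pi2 z)) (pair (g x) (h x)))).
  - intros x; now rewrite pi1_pair, pi2_pair.
  - apply (computable_comp _ _ Hf), computable_pair; assumption.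
Qed.

(** Primitive recursion with a parameter. Every later loop (arithmetic, finite sums, [argmax],
    halving, [scan]) is shown computable by presenting it as a [nat_rect] of this shape. *)
Lemma computable_rec (b n : nat -> nat) (step : nat -> nat -> nat -> nat) :
  computable b -> computable n ->
  computable (fun z => step (pi1 z) (pi1 (pi2 z)) (pi2 (pi2 z))) ->
  computable (fun x => nat_rect (fun _ => nat) (b x) (step x) (n x)).
Proof.
  intros [cb Hb] Hn [cs Hs].
  apply (computable2_app (fun x m => nat_rect (fun _ => nat) (b x) (step x) m)); trivial;
    [|apply computable_id].
  exists (cPrec cb cs); intros z.
  rewrite <- (pair_unpair z); fold (pi1 z) (pi2 z); generalize (pi1 z) (pi2 z); clear z.
  intros a m; rewrite pi1_pair, pi2_pair.
  induction m as [|m [k Hk]].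
  - destruct (Hb a) as [k Hk]; exists (S k); simpl; rewrite unpair_pair; exact Hk.
  - set (h := nat_rect _ _ _ m) in *.
    destruct (Hs (pair a (pair m h))) as [j Hj].
    rewrite !pi1_pair, !pi2_pair, pi1_pair in Hj.
    exists (S (j + k)); simpl; rewrite unpair_pair.
    rewrite (eval_le k (j + k) _ _ _ ltac:(lia) Hk).
    apply (eval_le j); [lia|exact Hj].
Qed.

Create HintDb comp.
#[global] Hint Resolve computable_id computable_const computable_pi1 computable_pi2 computable_S
  computable_pair : comp.

Lemma computable_add (f g : nat -> nat) :
  computable f -> computable g -> computable (fun x => f x + g x).
Proof.
  intros Hf Hg.
  apply (computable_ext (fun x => nat_rect (fun _ => nat) (g x) (fun _ h => S h) (f x))).
  - intros x; induction (f x) as [|m IH]; simpl; congruence.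
  - apply (computable_rec g f (fun _ _ h => S h)); auto with comp.
Qed.
#[global] Hint Resolve computable_add : comp.

Lemma computable_mul (f g : nat -> nat) :
  computable f -> computable g -> computable (fun x => f x * g x).
Proof.
  intros Hf Hg.
  apply (computable_ext (fun x => nat_rect (fun _ => nat) 0 (fun _ h => g x + h) (f x))).
  - intros x; induction (f x) as [|m IH]; simpl; congruence.
  - apply (computable_rec (fun _ => 0) f (fun x _ h => g x + h)); auto with comp.
    apply computable_add; auto with comp.
    apply (computable_comp g); auto with comp.
Qed.
#[global] Hint Resolve computable_mul : comp.

Lemma computable_pred (f : nat -> nat) : computable f -> computable (fun x => pred (f x)).
Proof.
  intros Hf.
  apply (computable_ext (fun x => nat_rect (fun _ => nat) 0 (fun m _ => m) (f x))).
  - intros x; now destruct (f x).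
  - apply (computable_rec (fun _ => 0) f (fun _ m _ => m)); auto with comp.
Qed.
#[global] Hint Resolve computable_pred : comp.

Lemma computable_sub (f g : nat -> nat) :
  computable f -> computable g -> computable (fun x => f x - g x).
Proof.
  intros Hf Hg.
  apply (computable_ext (fun x => nat_rect (fun _ => nat) (f x) (fun _ h => pred h) (g x))).
  - intros x; induction (g x) as [|m IH]; [symmetry; apply Nat.sub_0_r|].
    rewrite Nat.sub_succ_r, <- IH; reflexivity.
  - apply (computable_rec f g (fun _ _ h => pred h)); auto with comp.
Qed.
#[global] Hint Resolve computable_sub : comp.

Definition decidable_seq (d : nat -> bool) : Prop := computable (fun x => Nat.b2n (d x)).

Lemma computable_if (d : nat -> bool) (f g : nat -> nat) :
  decidable_seq d -> computable f -> computable g ->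
  computable (fun x => if d x then f x else g x).
Proof.
  intros Hd Hf Hg.
  apply (computable_ext (fun x => Nat.b2n (d x) * f x + (1 - Nat.b2n (d x)) * g x)).
  - intros x; destruct (d x); unfold Nat.b2n; lia.
  - unfold decidable_seq in Hd; auto 6 with comp.
Qed.

Lemma decidable_leb (f g : nat -> nat) :
  computable f -> computable g -> decidable_seq (fun x => f x <=? g x).
Proof.
  intros Hf Hg; apply (computable_ext (fun x => 1 - (f x - g x))).
  - intros x; destruct (Nat.leb_spec (f x) (g x)); unfold Nat.b2n; lia.
  - auto with comp.
Qed.

Lemma decidable_andb (d e : nat -> bool) :
  decidable_seq d -> decidable_seq e -> decidable_seq (fun x => d x && e x)%bool.
Proof.
  intros Hd He; apply (computable_ext (fun x => Nat.b2n (d x) * Nat.b2n (e x))).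
  - intros x; now destruct (d x), (e x).
  - unfold decidable_seq in *; auto with comp.
Qed.

Lemma decidable_negb (d : nat -> bool) :
  decidable_seq d -> decidable_seq (fun x => negb (d x)).
Proof.
  intros Hd; apply (computable_ext (fun x => 1 - Nat.b2n (d x))).
  - intros x; now destruct (d x).
  - unfold decidable_seq in *; auto with comp.
Qed.
#[global] Hint Resolve computable_if decidable_leb decidable_andb decidable_negb : comp.

Close Scope nat_scope.

(** * Computable sequences of rationals *)

(** Only the values of the codes matter, so sequences are handled by real arithmetic while their
    codes, which need not be in lowest terms, stay hidden. *)
Definition qcomputable (f : nat -> R) : Prop :=
  exists g, computable g /\ forall n, qdecode (g n) = f n.

Lemma qdecode_pair (a b c : nat) : qdecode (pair a (pair b c)) = (INR a - INR b) / INR (S c).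
Proof. unfold qdecode; now rewrite !unpair_pair. Qed.

Lemma qdecode_pi (x : nat) :
  qdecode x = (INR (pi1 x) - INR (pi1 (pi2 x))) / INR (S (pi2 (pi2 x))).
Proof.
  unfold qdecode, pi1, pi2; destruct (unpair x) as [a r]; simpl.
  now destruct (unpair r).
Qed.

Lemma INR_S_neq0 (n : nat) : INR (S n) <> 0.
Proof. apply not_0_INR; discriminate. Qed.

Lemma qcomputable_ext (f g : nat -> R) :
  (forall x, f x = g x) -> qcomputable f -> qcomputable g.
Proof. intros E [h [Hh Eh]]; exists h; split; [assumption|]; intros n; now rewrite <- E. Qed.

Lemma qcomputable_comp (f : nat -> R) (g : nat -> nat) :
  qcomputable f -> computable g -> qcomputable (fun x => f (g x)).
Proof.
  intros [h [Hh Eh]] Hg; exists (fun x => h (g x)); split; [|intros n; apply Eh].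
  now apply computable_comp.
Qed.

Lemma qcomputable_frac (a b c : nat -> nat) :
  computable a -> computable b -> computable c ->
  qcomputable (fun x => (INR (a x) - INR (b x)) / INR (S (c x))).
Proof.
  intros Ha Hb Hc; exists (fun x => pair (a x) (pair (b x) (c x))); split; [auto with comp|].
  intros n; apply qdecode_pair.
Qed.

Lemma qcomputable_INR (a : nat -> nat) : computable a -> qcomputable (fun x => INR (a x)).
Proof.
  intros Ha; apply (qcomputable_ext (fun x => (INR (a x) - INR 0) / INR 1)).
  - intros x; simpl; field.
  - apply (qcomputable_frac a (fun _ => O) (fun _ => O)); auto with comp.
Qed.

Lemma qcomputable_IZR (z : Z) : qcomputable (fun _ => IZR z).
Proof.
  apply (qcomputable_ext (fun _ => (INR (Z.to_nat z) - INR (Z.to_nat (- z))) / INR 1)).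
  - intros _; rewrite !INR_IZR_INZ; simpl (IZR (Z.of_nat 1)).
    rewrite <- minus_IZR, Rdiv_1_r; f_equal; lia.
  - apply (qcomputable_frac (fun _ => _) (fun _ => _) (fun _ => _)); auto with comp.
Qed.

(** Denominators are stored minus one, hence the [pred]. Addition gets its own function on codes
    because finite sums iterate it. *)
Definition qadd_code (x y : nat) : nat :=
  pair (pi1 x * S (pi2 (pi2 y)) + pi1 y * S (pi2 (pi2 x)))
    (pair (pi1 (pi2 x) * S (pi2 (pi2 y)) + pi1 (pi2 y) * S (pi2 (pi2 x)))
      (pred (S (pi2 (pi2 x)) * S (pi2 (pi2 y))))).

Lemma S_pred_mul_S (m n : nat) : S (pred (S m * S n)) = (S m * S n)%nat.
Proof. reflexivity. Qed.

Lemma qdecode_add_code (x y : nat) : qdecode (qadd_code x y) = qdecode x + qdecode y.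
Proof.
  unfold qadd_code; rewrite qdecode_pair, !qdecode_pi, S_pred_mul_S, !plus_INR, !mult_INR.
  field; split; apply INR_S_neq0.
Qed.

Lemma computable_add_code (f g : nat -> nat) :
  computable f -> computable g -> computable (fun x => qadd_code (f x) (g x)).
Proof. intros Hf Hg; unfold qadd_code; auto 10 with comp. Qed.

Lemma qcomputable_add (f g : nat -> R) :
  qcomputable f -> qcomputable g -> qcomputable (fun x => f x + g x).
Proof.
  intros [f' [Hf Ef]] [g' [Hg Eg]]; exists (fun x => qadd_code (f' x) (g' x)).
  split; [now apply computable_add_code|].
  intros n; now rewrite qdecode_add_code, Ef, Eg.
Qed.

Lemma qcomputable_mul (f g : nat -> R) :
  qcomputable f -> qcomputable g -> qcomputable (fun x => f x * g x).
Proof.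
  intros [x [Hx Ex]] [y [Hy Ey]].
  exists (fun n =>
    pair (pi1 (x n) * pi1 (y n) + pi1 (pi2 (x n)) * pi1 (pi2 (y n)))
      (pair (pi1 (x n) * pi1 (pi2 (y n)) + pi1 (pi2 (x n)) * pi1 (y n))
        (pred (S (pi2 (pi2 (x n))) * S (pi2 (pi2 (y n))))))).
  split; [auto 10 with comp|].
  intros n; rewrite <- Ex, <- Ey, qdecode_pair, !qdecode_pi, S_pred_mul_S, !plus_INR, !mult_INR.
  field; split; apply INR_S_neq0.
Qed.

Lemma qcomputable_opp (f : nat -> R) : qcomputable f -> qcomputable (fun x => - f x).
Proof.
  intros Hf; apply (qcomputable_ext (fun x => IZR (-1) * f x)); [intros x; ring|].
  apply qcomputable_mul; [apply qcomputable_IZR|assumption].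
Qed.

Lemma qcomputable_sub (f g : nat -> R) :
  qcomputable f -> qcomputable g -> qcomputable (fun x => f x - g x).
Proof. intros Hf Hg; apply qcomputable_add; [assumption|now apply qcomputable_opp]. Qed.

Lemma qcomputable_if (d : nat -> bool) (f g : nat -> R) :
  decidable_seq d -> qcomputable f -> qcomputable g ->
  qcomputable (fun x => if d x then f x else g x).
Proof.
  intros Hd [f' [Hf Ef]] [g' [Hg Eg]]; exists (fun x => if d x then f' x else g' x).
  split; [now apply computable_if|].
  intros n; now destruct (d n).
Qed.

Definition Rleb (x y : R) : bool := if Rle_dec x y then true else false.

Lemma Rleb_true (x y : R) : Rleb x y = true <-> x <= y.
Proof. unfold Rleb; now destruct (Rle_dec x y). Qed.

Lemma Rleb_false (x y : R) : Rleb x y = false <-> y < x.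
Proof. unfold Rleb; destruct (Rle_dec x y); split; intros; try easy; lra. Qed.


(** Cross-multiplied and rearranged without subtraction, so that for codes both sides are natural
    numbers and the comparison is decidable. *)
Lemma frac_le_iff (a b a' b' d d' : R) : 0 < d -> 0 < d' ->
  (a - b) / d <= (a' - b') / d' <-> a * d' + b' * d <= a' * d + b * d'.
Proof.
  intros Hd Hd'.
  replace ((a - b) / d) with ((a - b) * d' / (d * d')) by (field; lra).
  replace ((a' - b') / d') with ((a' - b') * d / (d * d')) by (field; lra).
  assert (0 < d * d') by now apply Rmult_lt_0_compat.
  split; intros H1.
  - apply (Rmult_le_compat_r (d * d')) in H1; [|lra].
    unfold Rdiv in H1; rewrite !Rmult_assoc, !(Rinv_l (d * d')) in H1 by lra; lra.
  - apply Rmult_le_compat_r; [apply Rlt_le, Rinv_0_lt_compat; assumption|lra].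
Qed.

Lemma qcomputable_Rleb (f g : nat -> R) :
  qcomputable f -> qcomputable g -> decidable_seq (fun x => Rleb (f x) (g x)).
Proof.
  intros [x [Hx Ex]] [y [Hy Ey]].
  apply (computable_ext (fun n => Nat.b2n (
    pi1 (x n) * S (pi2 (pi2 (y n))) + pi1 (pi2 (y n)) * S (pi2 (pi2 (x n))) <=?
    pi1 (y n) * S (pi2 (pi2 (x n))) + pi1 (pi2 (x n)) * S (pi2 (pi2 (y n))))%nat)).
  - intros n; f_equal; rewrite <- Ex, <- Ey, !qdecode_pi.
    apply Bool.eq_true_iff_eq; rewrite Nat.leb_le, Rleb_true.
    rewrite frac_le_iff by apply lt_0_INR, Nat.lt_0_succ.
    rewrite <- !mult_INR, <- !plus_INR.
    split; [apply le_INR|apply INR_le].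
  - apply decidable_leb; auto 10 with comp.
Qed.

Definition qcomputable2 (f : nat -> nat -> R) : Prop := qcomputable (fun z => f (pi1 z) (pi2 z)).

Lemma qcomputable2_app (f : nat -> nat -> R) (g h : nat -> nat) :
  qcomputable2 f -> computable g -> computable h -> qcomputable (fun x => f (g x) (h x)).
Proof.
  intros Hf Hg Hh.
  apply (qcomputable_ext (fun x => (fun z => f (pi1 z) (pi2 z)) (pair (g x) (h x)))).
  - intros x; now rewrite pi1_pair, pi2_pair.
  - apply (qcomputable_comp _ _ Hf); auto with comp.
Qed.

Fixpoint rsum (f : nat -> R) (n : nat) : R :=
  match n with O => 0 | S m => rsum f m + f m end.

Lemma qcomputable_rsum (f : nat -> nat -> R) (n : nat -> nat) :
  qcomputable2 f -> computable n ->
  qcomputable (fun x => rsum (f x) (n x)).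
Proof.
  intros [g [Hg Eg]] Hn.
  exists (fun x => nat_rect (fun _ => nat) 0%nat (fun m h => qadd_code h (g (pair x m))) (n x)).
  split.
  - apply (computable_rec (fun _ => O) n (fun x m h => qadd_code h (g (pair x m)))); auto with comp.
    apply computable_add_code; [auto with comp|].
    apply (computable_comp g); auto with comp.
  - intros x; induction (n x) as [|m IH]; simpl.
    + change 0%nat with (pair 0 (pair 0 0)); rewrite qdecode_pair; simpl; field.
    + now rewrite qdecode_add_code, IH, Eg, pi1_pair, pi2_pair.
Qed.

Lemma computable_pow2 (f : nat -> nat) : computable f -> computable (fun x => 2 ^ f x)%nat.
Proof.
  intros Hf.
  apply (computable_ext (fun x => nat_rect (fun _ => nat) 1%nat (fun _ h => h + h)%nat (f x))).
  - intros x; induction (f x) as [|m IH]; simpl; lia.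
  - apply (computable_rec (fun _ => 1%nat) f (fun _ _ h => h + h)%nat); auto with comp.
Qed.

Lemma qcomputable_half_pow (f : nat -> nat) :
  computable f -> qcomputable (fun x => (/ 2) ^ f x).
Proof.
  intros Hf.
  assert (Hp := computable_pow2 f Hf).
  apply (qcomputable_ext
    (fun x => (INR 1 - INR 0) / INR (S (pred (2 ^ f x))))).
  - intros x; rewrite Nat.succ_pred_pos by (apply Nat.neq_0_lt_0, Nat.pow_nonzero; discriminate).
    rewrite pow_INR, pow_inv; simpl INR.
    replace (1 + 1) with 2 by lra.
    field; apply pow_nonzero; lra.
  - apply (qcomputable_frac (fun _ => 1%nat) (fun _ => 0%nat)); auto with comp.
Qed.

Lemma qcomputable_const_frac (a b : nat) : qcomputable (fun _ => INR a / INR (S b)).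
Proof.
  apply (qcomputable_ext (fun _ => (INR a - INR 0) / INR (S b))).
  - intros _; rewrite Rminus_0_r; reflexivity.
  - apply (qcomputable_frac (fun _ => a) (fun _ => 0%nat) (fun _ => b)); auto with comp.
Qed.

#[global] Hint Resolve computable_pow2 qcomputable_const_frac qcomputable_add qcomputable_sub
  qcomputable_mul qcomputable_opp qcomputable_if qcomputable_Rleb qcomputable_half_pow
  qcomputable_INR qcomputable_IZR : comp.

(** An index is returned rather than a value, so that running maxima are computed by recursion on
    natural numbers. Ties go to the later index. *)
Fixpoint argmax (x : nat -> R) (m : nat) : nat :=
  match m with
  | O => O
  | S k => if Rleb (x (argmax x k)) (x (S k)) then S k else argmax x k
  end.

Lemma argmax_le (x : nat -> R) (m : nat) : (argmax x m <= m)%nat.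
Proof. induction m as [|m IH]; simpl; [lia|]; destruct Rleb; lia. Qed.

Lemma le_argmax (x : nat -> R) (m j : nat) : (j <= m)%nat -> x j <= x (argmax x m).
Proof.
  revert j; induction m as [|m IH]; intros j Hj.
  - replace j with O by lia; simpl; lra.
  - simpl; destruct (Rleb _ _) eqn:E; [apply Rleb_true in E|];
      (destruct (Nat.eq_dec j (S m)) as [->|Hne]; [|specialize (IH j ltac:(lia)); lra]).
    + lra.
    + apply Rleb_false in E; lra.
Qed.

Lemma computable_argmax (x : nat -> nat -> R) (m : nat -> nat) :
  qcomputable2 x -> computable m ->
  computable (fun n => argmax (x n) (m n)).
Proof.
  intros Hx Hm.
  apply (computable_ext (fun n => nat_rect (fun _ => nat) 0%nat
    (fun k h => if Rleb (x n h) (x n (S k)) then S k else h) (m n))).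
  - intros n; induction (m n) as [|k IH]; simpl; [reflexivity|now rewrite IH].
  - apply (computable_rec (fun _ => O) m
      (fun n k h => if Rleb (x n h) (x n (S k)) then S k else h)); auto with comp.
    apply computable_if; auto with comp.
    apply qcomputable_Rleb; apply qcomputable2_app; auto with comp.
Qed.

(** * Martin-Löf tests from sequences of rational intervals *)

Lemma half_pow_pos (n : nat) : 0 < (/ 2) ^ n.
Proof. apply pow_lt; lra. Qed.

Lemma half_pow_antitone (m n : nat) : (m <= n)%nat -> (/ 2) ^ n <= (/ 2) ^ m.
Proof.
  intros H; induction H as [|n H IH]; [lra|].
  simpl; assert (Hp := half_pow_pos n); lra.
Qed.

Lemma dyadic_bounds (s : bstring) : 0 <= dyadic s /\ dyadic s + (/ 2) ^ length s <= 1.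
Proof. induction s as [|[] s [IH1 IH2]]; simpl; lra. Qed.

Lemma cylinders_disjoint (s t : bstring) : ~ is_prefix s t -> ~ is_prefix t s ->
  dyadic s + (/ 2) ^ length s <= dyadic t \/ dyadic t + (/ 2) ^ length t <= dyadic s.
Proof.
  revert t; induction s as [|b s IH]; intros t Hst Hts.
  { exfalso; apply Hst; now exists t. }
  destruct t as [|c t]; [exfalso; apply Hts; now exists (b :: s)|].
  assert (Hs := dyadic_bounds s); assert (Ht := dyadic_bounds t).
  destruct (Bool.bool_dec b c) as [<-|Hbc].
  - destruct (IH t) as [H|H].
    + intros [u Hu]; apply Hst; exists u; simpl; congruence.
    + intros [u Hu]; apply Hts; exists u; simpl; congruence.
    + left; simpl; lra.
    + right; simpl; lra.
  - destruct b, c; try congruence; simpl; lra.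
Qed.

Lemma weight_filter (d : bstring -> bool) (S : list bstring) :
  weight S = weight (filter d S) + weight (filter (fun s => negb (d s)) S).
Proof.
  induction S as [|s S IH]; simpl; [lra|].
  unfold weight in *; simpl; destruct (d s); simpl; rewrite IH; lra.
Qed.

Lemma prefix_free_filter (d : bstring -> bool) (S : list bstring) :
  prefix_free S -> prefix_free (filter d S).
Proof.
  intros [HN HP]; split; [now apply NoDup_filter|].
  intros s t Hs Ht; apply filter_In in Hs, Ht; apply HP; tauto.
Qed.

(** Stands in for Lebesgue measure: disjoint cylinders inside an interval have total length at most
    that of the interval. One cylinder cuts the interval in two, and the induction treats each
    side. *)
Lemma prefix_free_weight_le (S : list bstring) (a b : R) : a <= b -> prefix_free S ->
  (forall s, In s S -> a <= dyadic s /\ dyadic s + (/ 2) ^ length s <= b) -> weight S <= b - a.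
Proof.
  remember (length S) as n eqn:Hn; assert (Hle : (length S <= n)%nat) by lia; clear Hn.
  revert S a b Hle; induction n as [|n IH]; intros S a b Hn Hab HS Hin.
  { destruct S; simpl in *; [lra|lia]. }
  destruct S as [|s S]; [simpl; lra|].
  (* The remaining cylinders lie either to the left or to the right of [s]. *)
  set (d := fun t => Rleb (dyadic t + (/ 2) ^ length t) (dyadic s)).
  change (weight (s :: S)) with ((/ 2) ^ length s + weight S).
  rewrite (weight_filter d S).
  destruct (Hin s (or_introl eq_refl)) as [H1 H2].
  assert (HS' : prefix_free S).
  { destruct HS as [HN HP]; inversion HN; split; [assumption|].
    intros u v Hu Hv; apply HP; now right. }
  assert (Hlen := filter_length_le d S).
  assert (Hlen' := filter_length_le (fun t => negb (d t)) S).
  simpl in Hn.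
  assert (HL : weight (filter d S) <= dyadic s - a).
  { apply IH; [lia|assumption|now apply prefix_free_filter|].
    intros t Ht; apply filter_In in Ht; destruct Ht as [Ht Hd]; apply Rleb_true in Hd.
    split; [apply Hin; now right|assumption]. }
  assert (HR : weight (filter (fun t => negb (d t)) S) <= b - (dyadic s + (/ 2) ^ length s)).
  { apply IH; [lia|lra|now apply prefix_free_filter|].
    intros t Ht; apply filter_In in Ht; destruct Ht as [Ht Hd].
    apply Bool.negb_true_iff, Rleb_false in Hd.
    split; [|apply Hin; now right].
    destruct HS as [HN HP]; inversion HN as [|? ? Hs]; subst.
    assert (Hst : s <> t) by congruence.
    destruct (cylinders_disjoint s t) as [Hd1|Hd1]; [| |assumption|lra];
      apply HP; simpl; auto. }
  lra.
Qed.

Lemma rsum_le (f g : nat -> R) (n : nat) :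
  (forall i, (i < n)%nat -> f i <= g i) -> rsum f n <= rsum g n.
Proof.
  induction n as [|n IH]; intros H; simpl; [lra|].
  assert (H1 := H n (Nat.lt_succ_diag_r n)).
  assert (rsum f n <= rsum g n) by (apply IH; auto); lra.
Qed.

Lemma rsum_plus (f g : nat -> R) (n : nat) :
  rsum (fun i => f i + g i) n = rsum f n + rsum g n.
Proof. induction n as [|n IH]; simpl; [lra|rewrite IH; lra]. Qed.

Lemma rsum_scal (c : R) (f : nat -> R) (n : nat) : rsum (fun i => c * f i) n = c * rsum f n.
Proof. induction n as [|n IH]; simpl; [lra|rewrite IH; lra]. Qed.

Lemma rsum_S_l (f : nat -> R) (n : nat) : rsum f (S n) = f O + rsum (fun i => f (S i)) n.
Proof. induction n as [|n IH]; [simpl; lra|]. simpl in *; lra. Qed.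

Lemma rsum_mono (f : nat -> R) (m n : nat) :
  (forall i, 0 <= f i) -> (m <= n)%nat -> rsum f m <= rsum f n.
Proof. intros Hf H; induction H as [|n H IH]; simpl; [lra|]. specialize (Hf n); lra. Qed.

Lemma rsum_half_pow (c n : nat) : rsum (fun i => (/ 2) ^ (c + S i)) n <= (/ 2) ^ c.
Proof.
  assert (H : rsum (fun i => (/ 2) ^ (c + S i)) n = (/ 2) ^ c - (/ 2) ^ (c + n)).
  { induction n as [|n IH]; simpl; [rewrite Nat.add_0_r; lra|].
    rewrite IH, Nat.add_succ_r; simpl; lra. }
  rewrite H; assert (Hp := half_pow_pos (c + n)); lra.
Qed.

Definition indic (b : bool) : R := if b then 1 else 0.

(** Double counting, a finite form of Markov's inequality: on the right each string contributes its
    measure once for every [i] that accepts it. *)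
Lemma weight_count_le (d : nat -> bstring -> bool) (S : list bstring) (N : R) (K : nat) :
  (forall s, In s S -> N <= rsum (fun i => indic (d i s)) K) ->
  N * weight S <= rsum (fun i => weight (filter (d i) S)) K.
Proof.
  induction S as [|s S IH]; intros H.
  - simpl; rewrite Rmult_0_r; apply Req_le; induction K as [|K IHK]; simpl; [reflexivity|].
    rewrite <- IHK by (intros s []); lra.
  - assert (IH' := IH (fun t Ht => H t (or_intror Ht))).
    assert (Hs := H s (or_introl eq_refl)).
    assert (E : rsum (fun i => weight (filter (d i) (s :: S))) K
      = (/ 2) ^ length s * rsum (fun i => indic (d i s)) K
        + rsum (fun i => weight (filter (d i) S)) K).
    { rewrite <- rsum_scal, <- rsum_plus.
      clear; induction K as [|K IHK]; simpl in *; [reflexivity|rewrite IHK].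
      unfold indic; destruct (d K s); simpl; lra. }
    rewrite E; change (weight (s :: S)) with ((/ 2) ^ length s + weight S).
    assert (Hp := half_pow_pos (length s)).
    apply (Rmult_le_compat_l ((/ 2) ^ length s)) in Hs; lra.
Qed.

Definition half_iter (m i : nat) : nat := nat_rect (fun _ => nat) m (fun _ h => Nat.div2 h) i.

Lemma half_iter_S (m i : nat) : half_iter m (S i) = half_iter (Nat.div2 m) i.
Proof. induction i as [|i IH]; [reflexivity|]. simpl in *; now rewrite IH. Qed.

(** [bits_of] changes its second argument at each call, which does not fit [computable_rec]; a sum
    over bit positions does. *)
Lemma dyadic_bits_of (l m : nat) :
  dyadic (bits_of l m) = rsum (fun i => if Nat.odd (half_iter m i) then (/ 2) ^ S i else 0) l.
Proof.
  revert m; induction l as [|l IH]; intros m; [reflexivity|].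
  rewrite rsum_S_l; simpl dyadic; rewrite IH, <- rsum_scal.
  f_equal; [simpl; destruct (Nat.odd m); lra|].
  apply Rle_antisym; apply rsum_le; intros i _; rewrite half_iter_S;
    destruct (Nat.odd _); simpl; lra.
Qed.

Lemma length_bits_of (l m : nat) : length (bits_of l m) = l.
Proof. revert m; induction l as [|l IH]; intros m; simpl; [|rewrite IH]; reflexivity. Qed.

Lemma bits_of_in_cyl (l : nat) (y : R) :
  0 <= y < 1 -> exists m, in_cyl (bits_of l m) y.
Proof.
  unfold in_cyl.
  revert y; induction l as [|l IH]; intros y Hy; [exists O; simpl; lra|].
  destruct (Rlt_le_dec y (/ 2)) as [H|H].
  - destruct (IH (2 * y)) as [m Hm]; [lra|]; exists (2 * m)%nat.
    cbn [bits_of]; rewrite Nat.odd_even, Nat.div2_double; simpl; lra.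
  - destruct (IH (2 * y - 1)) as [m Hm]; [lra|]; exists (S (2 * m)).
    cbn [bits_of]; rewrite Nat.odd_succ, Nat.even_even, Nat.div2_succ_double; simpl; lra.
Qed.

Lemma computable_div2 (f : nat -> nat) : computable f -> computable (fun x => Nat.div2 (f x)).
Proof.
  intros Hf.
  (* With [h] the half of [m], the test [m <= h + h] says that [m] is even, in which case [S m] has
     the same half. *)
  apply (computable_ext (fun x =>
    nat_rect (fun _ => nat) 0 (fun m h => if m <=? h + h then h else S h) (f x))%nat).
  - intros x; induction (f x) as [|m IH]; [reflexivity|]; simpl nat_rect; rewrite IH.
    destruct (Nat.Even_or_Odd m) as [[k ->]|[k ->]].
    + rewrite Nat.div2_double, Nat.div2_succ_double.
      destruct (Nat.leb_spec (2 * k) (k + k)); lia.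
    + replace (S (2 * k + 1)) with (2 * S k)%nat by lia.
      rewrite Nat.add_1_r, Nat.div2_double, Nat.div2_succ_double.
      destruct (Nat.leb_spec (S (2 * k)) (k + k)); lia.
  - apply (computable_rec (fun _ => 0) f (fun _ m h => if m <=? h + h then h else S h))%nat;
      auto 10 with comp.
Qed.

Lemma decidable_odd (f : nat -> nat) : computable f -> decidable_seq (fun x => Nat.odd (f x)).
Proof.
  intros Hf.
  apply (computable_ext (fun x => Nat.b2n (negb (f x <=? Nat.div2 (f x) + Nat.div2 (f x))))%nat).
  - intros x; f_equal; destruct (Nat.Even_or_Odd (f x)) as [[k ->]|[k ->]].
    + rewrite Nat.odd_even, Nat.div2_double; destruct (Nat.leb_spec (2 * k) (k + k)); simpl; lia.
    + rewrite Nat.odd_odd, Nat.add_1_r, Nat.div2_succ_double.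
      destruct (Nat.leb_spec (S (2 * k)) (k + k)); simpl; lia.
  - assert (H := computable_div2 f Hf).
    apply (decidable_negb (fun x => f x <=? Nat.div2 (f x) + Nat.div2 (f x))%nat); auto with comp.
Qed.

Lemma qcomputable_dyadic (l m : nat -> nat) : computable l -> computable m ->
  qcomputable (fun x => dyadic (bits_of (l x) (m x))).
Proof.
  intros Hl Hm.
  apply (qcomputable_ext (fun x =>
    rsum (fun i => if Nat.odd (half_iter (m x) i) then (/ 2) ^ S i else IZR 0) (l x))).
  { intros x; symmetry; apply dyadic_bits_of. }
  apply (qcomputable_rsum
    (fun x i => if Nat.odd (half_iter (m x) i) then (/ 2) ^ S i else IZR 0)); [|assumption].
  apply qcomputable_if; auto with comp.
  apply decidable_odd.
  apply (computable_rec (fun z => m (pi1 z)) pi2 (fun _ _ h => Nat.div2 h)).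
  - apply (computable_comp m); auto with comp.
  - apply computable_pi2; auto with comp.
  - apply computable_div2; auto with comp.
Qed.
#[global] Hint Resolve qcomputable_dyadic : comp.

(* The [n]-th component of the test consists of the cylinders contained in at least [T n] of the
   slightly enlarged intervals [a n i - e, b n i + e]; the enlargement makes room for a whole
   cylinder around [z], and only the first [length s] intervals are inspected for [s]. *)
Section IntervalTest.
Variables (z : R) (a b : nat -> nat -> R) (T : nat -> R).
Hypotheses (Ha : qcomputable2 a) (Hb : qcomputable2 b) (HT : qcomputable T)
  (T_ge1 : forall n, 1 <= T n) (Hab : forall n i, a n i <= b n i)
  (Hsum : forall n K, rsum (fun i => b n i - a n i) K <= T n * (/ 2) ^ S n)
  (Hz : forall n, exists K, T n <= rsum (fun i => indic (Rleb (a n i) z && Rleb z (b n i))) K).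

Let off : R := IZR (Int_part z).
Let e (n i : nat) : R := (/ 2) ^ (S (S n) + S i).
Let inside (n i : nat) (s : bstring) : bool :=
  (Rleb (a n i - e n i) (dyadic s + off)
   && Rleb (dyadic s + off + (/ 2) ^ length s) (b n i + e n i))%bool.
Let good (n : nat) (s : bstring) : bool :=
  Rleb (T n) (rsum (fun i => indic (inside n i s)) (length s)).
(** Since [good] is decidable, [k] itself is read as the code of a pair of a level and a string, and
    is emitted exactly when it passes. *)
Let test (k : nat) : nat :=
  if good (pi1 k) (bits_of (pi1 (pi2 k)) (pi2 (pi2 k))) then S k else O.

Lemma in_test_iff (n : nat) (s : bstring) :
  in_test test n s <-> good n s = true /\ exists m, s = bits_of (length s) m.
Proof.
  unfold in_test, sdecode; split.
  - intros [k [m [Hk [Hn Hs]]]]; unfold test in Hk; fold (pi1 m) in Hn.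
    destruct (good _ _) eqn:E; [|discriminate].
    injection Hk as <-; unfold pi1, pi2 in *.
    destruct (unpair (snd (unpair k))) as [l r]; simpl in E; subst.
    split; [assumption|exists r; now rewrite length_bits_of].
  - intros [H [m Hm]]; exists (pair n (pair (length s) m)), (pair n (pair (length s) m)).
    unfold test; rewrite !pi2_pair, !pi1_pair, <- Hm, H.
    rewrite !unpair_pair; simpl; now rewrite unpair_pair.
Qed.

Lemma computable_test : computable test.
Proof.
  apply computable_if; auto with comp.
  apply (computable_ext (fun k => Nat.b2n (Rleb (T (pi1 k))
    (rsum (fun i => indic (Rleb (a (pi1 k) i - e (pi1 k) i)
              (dyadic (bits_of (pi1 (pi2 k)) (pi2 (pi2 k))) + off)
        && Rleb (dyadic (bits_of (pi1 (pi2 k)) (pi2 (pi2 k))) + off + (/ 2) ^ pi1 (pi2 k))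
              (b (pi1 k) i + e (pi1 k) i))) (pi1 (pi2 k)))))).
  { intros k; unfold good, inside; now rewrite length_bits_of. }
  apply qcomputable_Rleb.
  { apply (qcomputable_comp T); auto with comp. }
  apply (qcomputable_rsum (fun k i => indic (Rleb (a (pi1 k) i - e (pi1 k) i)
              (dyadic (bits_of (pi1 (pi2 k)) (pi2 (pi2 k))) + off)
        && Rleb (dyadic (bits_of (pi1 (pi2 k)) (pi2 (pi2 k))) + off + (/ 2) ^ pi1 (pi2 k))
              (b (pi1 k) i + e (pi1 k) i)))); [|auto with comp].
  unfold qcomputable2, indic, off, e.
  apply qcomputable_if; auto with comp.
  assert (Ha' : qcomputable (fun x => a (pi1 (pi1 x)) (pi2 x)))
    by (apply qcomputable2_app; auto with comp).
  assert (Hb' : qcomputable (fun x => b (pi1 (pi1 x)) (pi2 x)))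
    by (apply qcomputable2_app; auto with comp).
  auto 20 with comp.
Qed.

Lemma test_weight (n : nat) (S : list bstring) :
  prefix_free S -> (forall s, In s S -> in_test test n s) -> weight S <= (/ 2) ^ n.
Proof.
  intros HS Hin.
  assert (HK : exists K, forall s, In s S -> (length s <= K)%nat).
  { clear; induction S as [|s S [K IH]]; [now exists O|].
    exists (Nat.max (length s) K); intros t [->|Ht]; [lia|]. specialize (IH t Ht); lia. }
  destruct HK as [K HK].
  assert (H1 : T n * weight S <= rsum (fun i => weight (filter (inside n i) S)) K).
  { apply (weight_count_le (inside n)).
    intros s Hs; specialize (Hin s Hs); apply in_test_iff in Hin.
    destruct Hin as [Hg _]; apply Rleb_true in Hg.
    eapply Rle_trans; [exact Hg|].
    apply rsum_mono; [|auto].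
    intros i; unfold indic; destruct (inside n i s); lra. }
  assert (H2 : rsum (fun i => weight (filter (inside n i) S)) K
    <= rsum (fun i => (b n i - a n i) + 2 * e n i) K).
  { apply rsum_le; intros i _.
    assert (Hp : 0 < e n i) by apply half_pow_pos.
    replace (b n i - a n i + 2 * e n i)
      with ((b n i + e n i - off) - (a n i - e n i - off)) by ring.
    apply prefix_free_weight_le.
    - specialize (Hab n i); lra.
    - now apply prefix_free_filter.
    - intros s Hs; apply filter_In in Hs; destruct Hs as [_ Hs].
      apply andb_prop in Hs; destruct Hs as [Hs1 Hs2]; apply Rleb_true in Hs1, Hs2; lra. }
  rewrite rsum_plus, rsum_scal in H2.
  assert (H3 := rsum_half_pow (Datatypes.S (Datatypes.S n)) K).
  assert (H4 := Hsum n K).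
  fold (e n) in H3; change (rsum (e n) K <= (/ 2) ^ Datatypes.S (Datatypes.S n)) in H3.
  assert (Hp := half_pow_pos n); assert (HT1 := T_ge1 n).
  simpl in H3, H4.
  (* The intervals contribute at most [T n * (/ 2) ^ S n]. The enlargements contribute twice
     [(/ 2) ^ S (S n)], which is again at most [T n * (/ 2) ^ S n] because [T n >= 1]. *)
  assert (T n * weight S <= T n * (/ 2) ^ n).
  { assert ((/ 2) ^ n <= T n * (/ 2) ^ n) by nra; lra. }
  apply (Rmult_le_reg_l (T n)); lra.
Qed.

Lemma interval_test : ~ ML_random z.
Proof.
  intros Hr; apply Hr; exists test; split.
  { split; [apply computable_test|apply test_weight]. }
  intros n; destruct (Hz n) as [K HK].
  assert (Hy := base_fp z).
  (* The length is chosen so that the cylinder is no wider than the margin [e n i] for every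
     [i < K], and so that at least the first [K] intervals are inspected. *)
  destruct (bits_of_in_cyl (S (S n) + S K) (frac_part z)) as [m Hm]; [lra|].
  exists (bits_of (S (S n) + S K) m); split; [|assumption].
  apply in_test_iff; rewrite length_bits_of; split; [|now exists m].
  unfold in_cyl in Hm; rewrite length_bits_of in Hm.
  apply Rleb_true; rewrite length_bits_of.
  apply (Rle_trans _ _ _ HK).
  apply Rle_trans with (rsum (fun i => indic (inside n i (bits_of (S (S n) + S K) m))) K).
  - apply rsum_le; intros i Hi.
    destruct (Rleb (a n i) z && Rleb z (b n i))%bool eqn:E;
      [|unfold indic; destruct (inside _ _ _); lra].
    apply andb_prop in E; destruct E as [E1 E2]; apply Rleb_true in E1, E2.
    assert (He := half_pow_antitone (S (S n) + S i) (S (S n) + S K) ltac:(lia)).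
    fold (e n i) in He.
    assert (Hoff : z = off + frac_part z) by (unfold off, frac_part; ring).
    unfold inside; rewrite length_bits_of.
    rewrite !(proj2 (Rleb_true _ _)) by lra; simpl; lra.
  - apply rsum_mono; [|lia].
    intros i; unfold indic; destruct (inside _ _ _); lra.
Qed.
End IntervalTest.

(** * Left-c.e. and right-c.e. reals *)

Lemma rsum_telescope (x : nat -> R) (n : nat) : rsum (fun i => x (S i) - x i) n = x n - x O.
Proof. induction n as [|n IH]; simpl; [lra|rewrite IH; lra]. Qed.

Lemma indic_nonneg (b : bool) : 0 <= indic b.
Proof. destruct b; simpl; lra. Qed.

Lemma rsum_indic_ge1 (d : nat -> bool) (k : nat) :
  d k = true -> 1 <= rsum (fun i => indic (d i)) (S k).
Proof.
  intros H; simpl; rewrite H; simpl.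
  assert (H0 := rsum_mono (fun i => indic (d i)) 0 k (fun i => indic_nonneg _) (Nat.le_0_l k)).
  simpl in H0; lra.
Qed.

Lemma rsum_indic_unbounded (d : nat -> bool) :
  (forall N, exists k, (N <= k)%nat /\ d k = true) ->
  forall j, exists K, INR j <= rsum (fun i => indic (d i)) K.
Proof.
  intros Hd j; induction j as [|j [K HK]]; [exists O; simpl; lra|].
  destruct (Hd K) as [k [HKk Hk]]; exists (S k).
  rewrite S_INR; simpl rsum; rewrite Hk; simpl.
  assert (H := rsum_mono (fun i => indic (d i)) K k (fun i => indic_nonneg _) HKk); lra.
Qed.

Lemma least_nat (P : nat -> Prop) :
  (exists n, P n) -> exists n, P n /\ forall m, (m < n)%nat -> ~ P m.
Proof.
  intros H; destruct (dec_inh_nat_subset_has_unique_least_element P (fun n => classic (P n)) H)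
    as [n [[Hn Hmin] _]].
  exists n; split; [assumption|]; intros m Hm HP; specialize (Hmin m HP); lia.
Qed.

Lemma first_failure (P : nat -> Prop) (s v : nat) : P s -> ~ P v -> (s <= v)%nat ->
  exists u, (s <= u)%nat /\ (forall w, (s <= w <= u)%nat -> P w) /\ ~ P (S u).
Proof.
  intros Hs Hv Hsv.
  destruct (least_nat (fun n => (s <= n)%nat /\ ~ P n)) as [n [[H1 H2] H3]]; [now exists v|].
  destruct n as [|u]; [now replace s with O in Hs by lia|].
  destruct (Nat.eq_dec s (S u)) as [->|Hne]; [contradiction|].
  exists u; repeat split; [lia| |assumption].
  intros w Hw; apply NNPP; intros Hnw; apply (H3 w); [lia|now split].
Qed.

Lemma left_ce_iff (x : R) :
  left_ce x <-> exists u, qcomputable u /\ Un_growing u /\ Un_cv u x.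
Proof.
  split.
  - intros [f [Hf [Hm Hc]]]; exists (fun n => qdecode (f n)); repeat split; trivial.
    now exists f.
  - intros [u [[f [Hf E]] [Hm Hc]]]; exists f; repeat split; trivial.
    + intros n; rewrite !E; apply Hm.
    + intros eps He; destruct (Hc eps He) as [N HN]; exists N; intros n Hn.
      rewrite E; now apply HN.
Qed.

Lemma right_ce_iff (x : R) :
  right_ce x <-> exists u, qcomputable u /\ Un_decreasing u /\ Un_cv u x.
Proof.
  split.
  - intros [f [Hf [Hm Hc]]]; exists (fun n => qdecode (f n)); repeat split; trivial.
    now exists f.
  - intros [u [[f [Hf E]] [Hm Hc]]]; exists f; repeat split; trivial.
    + intros n; rewrite !E; apply Hm.
    + intros eps He; destruct (Hc eps He) as [N HN]; exists N; intros n Hn.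
      rewrite E; now apply HN.
Qed.

Lemma Un_cv_const (c : R) : Un_cv (fun _ => c) c.
Proof. intros eps He; exists O; intros n _; unfold R_dist; rewrite Rminus_diag, Rabs_R0; lra. Qed.

Lemma Un_cv_scal (c : R) (u : nat -> R) (l : R) : Un_cv u l -> Un_cv (fun n => c * u n) (c * l).
Proof. apply CV_mult, Un_cv_const. Qed.

Lemma left_ce_opp (x : R) : left_ce (- x) -> right_ce x.
Proof.
  rewrite left_ce_iff, right_ce_iff; intros [u [Hu [Hm Hc]]].
  exists (fun n => - u n); repeat split; [auto with comp|intros n; specialize (Hm n); lra|].
  rewrite <- (Ropp_involutive x); now apply CV_opp.
Qed.

Lemma Un_cv_eventually_lt (u : nat -> R) (l c : R) :
  Un_cv u l -> l < c -> exists N, forall n, (N <= n)%nat -> u n < c.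
Proof.
  intros H Hc; destruct (H (c - l)) as [N HN]; [lra|]; exists N; intros n Hn.
  specialize (HN n Hn); unfold R_dist in HN; apply Rabs_def2 in HN; lra.
Qed.

Lemma Un_cv_eventually_gt (u : nat -> R) (l c : R) :
  Un_cv u l -> c < l -> exists N, forall n, (N <= n)%nat -> c < u n.
Proof.
  intros H Hc; destruct (H (l - c)) as [N HN]; [lra|]; exists N; intros n Hn.
  specialize (HN n Hn); unfold R_dist in HN; apply Rabs_def2 in HN; lra.
Qed.

(** The running maximum of the tail is increasing and is squeezed between the sequence and its
    limit. *)
Lemma left_ce_of_eventually_le (u : nat -> R) (l : R) (N : nat) :
  qcomputable u -> Un_cv u l -> (forall n, (N <= n)%nat -> u n <= l) -> left_ce l.
Proof.
  intros Hu Hc Hle; apply left_ce_iff.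
  set (v := fun i => u (N + i)%nat).
  assert (Hv : qcomputable v) by (apply (qcomputable_comp u); auto with comp).
  exists (fun n => v (argmax v n)); repeat split.
  - apply (qcomputable_comp v); [assumption|].
    apply (computable_argmax (fun _ => v)); [|auto with comp].
    apply (qcomputable_comp v); auto with comp.
  - intros n; apply le_argmax; assert (H := argmax_le v n); lia.
  - intros eps He; destruct (Hc eps He) as [N' HN']; exists N'; intros n Hn.
    specialize (HN' (N + n)%nat ltac:(lia)); unfold R_dist in *.
    assert (H1 := le_argmax v n n (le_n n)).
    assert (H2 : v (argmax v n) <= l) by (apply Hle; lia).
    change (u (N + n)%nat) with (v n) in HN'.
    apply Rabs_def2 in HN'; apply Rabs_def1; lra.
Qed.

Lemma infinitely_often_above (u : nat -> R) (l : R) : qcomputable u -> Un_cv u l -> ~ left_ce l ->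
  forall N, exists s, (N <= s)%nat /\ l < u s.
Proof.
  intros Hu Hc Hl N; apply NNPP; intros H; apply Hl.
  apply (left_ce_of_eventually_le u l N Hu Hc).
  intros n Hn; apply Rnot_lt_le; intros Hlt; apply H; now exists n.
Qed.

(** Since [u s0] is above the limit, all but finitely many terms are below it, and a maximum over
    finitely many terms suffices. *)
Lemma tail_max_attained (u : nat -> R) (l : R) (N s0 : nat) :
  Un_cv u l -> (N <= s0)%nat -> l < u s0 ->
  exists s, (N <= s)%nat /\ l < u s /\ forall w, (N <= w)%nat -> u w <= u s.
Proof.
  intros Hc HN Hl; destruct (Un_cv_eventually_lt u l _ Hc Hl) as [N' HN'].
  set (v := fun i => u (N + i)%nat).
  assert (Hmax := le_argmax v (N' + s0)).
  exists (N + argmax v (N' + s0))%nat; fold (v (argmax v (N' + s0))).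
  assert (Hs0 : u s0 <= v (argmax v (N' + s0))).
  { replace s0 with (N + (s0 - N))%nat at 1 by lia; apply Hmax; lia. }
  repeat split; [lia|lra|]; intros w Hw.
  destruct (Nat.le_gt_cases N' w) as [H|H].
  - specialize (HN' w H); lra.
  - replace w with (N + (w - N))%nat by lia; apply Hmax; lia.
Qed.

(** * Consequences of randomness for one-sided approximations *)

Lemma exists_pow2_ge (x : R) : exists c, x <= 2 ^ c.
Proof.
  destruct (Pow_x_infinity 2 ltac:(rewrite Rabs_right; lra) x) as [c Hc]; exists c.
  specialize (Hc c (le_n c)); rewrite Rabs_right in Hc; [lra|].
  apply Rle_ge, Rlt_le, pow_lt; lra.
Qed.

Lemma pow2_half_pow (n : nat) : 2 ^ n * (/ 2) ^ n = 1.
Proof. rewrite <- Rpow_mult_distr, Rinv_r by lra; apply pow1. Qed.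

Lemma computable_real_not_random (x : R) : left_ce x -> right_ce x -> ~ ML_random x.
Proof.
  intros Hl Hr; apply left_ce_iff in Hl; apply right_ce_iff in Hr.
  destruct Hl as [u [Hu [Hug Huc]]], Hr as [v [Hv [Hvd Hvc]]].
  assert (Hux := growing_ineq u x Hug Huc); assert (Hvx := decreasing_ineq v x Hvd Hvc).
  set (w := fun k => v k - u k).
  assert (Hw0 : forall k, 0 <= w k)
    by (intros k; unfold w; specialize (Hux k); specialize (Hvx k); lra).
  assert (Hwd : Un_decreasing w)
    by (intros k; unfold w; specialize (Hug k); specialize (Hvd k); lra).
  assert (Hwc : Un_cv w 0) by (replace 0 with (x - x) by ring; now apply CV_minus).
  (* For each [n], only the first interval [u k, v k] of length at most 2^-(n+1) is kept. *)
  set (first := fun n k => (Rleb (w k) ((/ 2) ^ S n)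
    && negb (Rleb (w (pred k)) ((/ 2) ^ S n) && (1 <=? k)%nat))%bool).
  apply (interval_test x (fun _ k => u k) (fun n k => u k + if first n k then w k else IZR 0)
    (fun _ => IZR 1)).
  - apply (qcomputable_comp u); auto with comp.
  - assert (Hw : qcomputable w) by (unfold w; auto with comp).
    assert (Hw1 : qcomputable (fun z => w (pi2 z)))
      by (apply (qcomputable_comp w); auto with comp).
    assert (Hw2 : qcomputable (fun z => w (pred (pi2 z))))
      by (apply (qcomputable_comp w); auto with comp).
    apply qcomputable_add; [apply (qcomputable_comp u); auto with comp|].
    unfold first; auto 10 with comp.
  - apply qcomputable_IZR.
  - intros _; lra.
  - intros n k; specialize (Hw0 k); destruct (first n k); lra.
  - intros n K.
    apply Rle_trans with (rsum (fun k => if first n k then w k else 0) K);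
      [apply rsum_le; intros; lra|].
    rewrite Rmult_1_l; set (h := (/ 2) ^ S n).
    assert (Hh : 0 < h) by apply half_pow_pos.
    (* The second half records that nothing has been kept as long as [w] is above [h]; this is what
       limits the sum to a single interval. *)
    enough (rsum (fun k => if first n k then w k else 0) K <= h /\
      (K = O \/ h < w (pred K) -> rsum (fun k => if first n k then w k else 0) K <= 0)) by tauto.
    induction K as [|K [IH1 IH2]]; [simpl; split; intros; lra|].
    cbn [rsum pred].
    destruct (Rle_lt_dec (w K) h) as [HK|HK].
    + split; [|intros [H|H]; [discriminate|lra]].
      destruct (first n K) eqn:E; [|lra].
      apply andb_prop in E; destruct E as [_ E]; apply Bool.negb_true_iff in E.
      enough (rsum (fun k => if first n k then w k else 0) K <= 0) by lra.
      apply IH2; apply Bool.andb_false_iff in E; destruct E as [E|E].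
      * right; now apply Rleb_false in E.
      * left; destruct K; [reflexivity|discriminate].
    + replace (first n K) with false
        by (unfold first; fold h; now rewrite (proj2 (Rleb_false (w K) _) HK)).
      assert (H0 : K = O \/ h < w (pred K)).
      { destruct K as [|K]; [now left|right]; specialize (Hwd K); simpl in *; lra. }
      specialize (IH2 H0); split; intros; lra.
  - intros n; destruct (Un_cv_eventually_lt w 0 _ Hwc (half_pow_pos (S n))) as [N HN].
    destruct (least_nat (fun k => w k <= (/ 2) ^ S n)) as [k [Hk Hmin]].
    { exists N; apply Rlt_le, HN, le_n. }
    exists (S k).
    apply (rsum_indic_ge1 (fun i => Rleb (u i) x && Rleb x (u i + _))%bool).
    replace (first n k) with true.
    + specialize (Hux k); specialize (Hvx k); unfold w.
      rewrite !(proj2 (Rleb_true _ _)) by lra; reflexivity.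
    + symmetry; unfold first; rewrite (proj2 (Rleb_true _ _) Hk); simpl.
      apply Bool.negb_true_iff, Bool.andb_false_iff.
      (* Index 0 has no predecessor and [pred 0 = 0]; the guard [1 <=? k] in [first] lets it be
         kept. *)
      destruct k as [|k]; [now right|left].
      apply Rleb_false, Rnot_le_lt, Hmin; simpl; lia.
Qed.

(* Kucera-Slaman. Suppose that no [b - (1/2)^k a] is left-c.e. With [x], [y] approximating [a], [b]
   and [e = (1/2)^k], the maximum [M] of [y - e x] is then attained, say at [s], and exceeds
   [b - e a], so that [b] lies between [M + e x_s = y_s] and [M + e a]: it is covered by the
   intervals [M_u + e x_u, M_u + e x_(u+1)], where [M_u] is the running maximum. *)
Lemma random_solovay_complete (a b : R) : left_ce a -> left_ce b -> ML_random b ->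
  exists k, right_ce ((/ 2) ^ k * a - b).
Proof.
  intros Ha Hb Hrand; apply NNPP; intros Hno; revert Hrand.
  apply left_ce_iff in Ha, Hb.
  destruct Ha as [x [Hx [Hxg Hxc]]], Hb as [y [Hy [Hyg Hyc]]].
  assert (Hxa := growing_ineq x a Hxg Hxc); assert (Hyb := growing_ineq y b Hyg Hyc).
  destruct (exists_pow2_ge (a - x O)) as [c Hc].
  (* As [2 ^ c] bounds the total increase of [x], the intervals of level [n], of total length at
     most [eps n * (a - x O)], stay within [(/ 2) ^ S n]. *)
  set (eps := fun n => (/ 2) ^ (S n + c)).
  set (X := fun n i => y i - eps n * x i).
  set (M := fun n u => X n (argmax (X n) u)).
  assert (HX : qcomputable2 X).
  { assert (qcomputable (fun z => x (pi2 z))) by (apply (qcomputable_comp x); auto with comp).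
    assert (qcomputable (fun z => y (pi2 z))) by (apply (qcomputable_comp y); auto with comp).
    unfold qcomputable2, X, eps; auto 10 with comp. }
  assert (Heps : qcomputable (fun z => eps (pi1 z))) by (unfold eps; auto with comp).
  assert (HM : qcomputable2 M).
  { apply (qcomputable2_app X); [assumption|auto with comp|].
    apply computable_argmax; [|auto with comp].
    apply (qcomputable2_app X); auto with comp. }
  apply (interval_test b (fun n u => M n u + eps n * x u) (fun n u => M n u + eps n * x (S u))
    (fun _ => IZR 1)).
  - apply qcomputable_add; [assumption|apply qcomputable_mul; [assumption|]].
    apply (qcomputable_comp x); auto with comp.
  - apply qcomputable_add; [assumption|apply qcomputable_mul; [assumption|]].
    apply (qcomputable_comp x); auto with comp.
  - apply qcomputable_IZR.
  - intros _; lra.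
  - intros n u; specialize (Hxg u); assert (Hp := half_pow_pos (S n + c)); fold (eps n) in Hp.
    apply Rplus_le_compat_l, Rmult_le_compat_l; lra.
  - intros n K.
    apply Rle_trans with (rsum (fun i => eps n * (x (S i) - x i)) K);
      [apply rsum_le; intros; lra|].
    rewrite rsum_scal, rsum_telescope, Rmult_1_l; unfold eps; rewrite pow_add, Rmult_assoc.
    assert (Hp := half_pow_pos (S n)); assert (Hpc := half_pow_pos c); specialize (Hxa K).
    assert (H1 : (/ 2) ^ c * (x K - x O) <= (/ 2) ^ c * 2 ^ c)
      by (apply Rmult_le_compat_l; lra).
    rewrite (Rmult_comm _ (2 ^ c)), pow2_half_pow in H1.
    apply (Rmult_le_compat_l ((/ 2) ^ S n)) in H1; lra.
  - intros n.
    assert (HXn : qcomputable (X n)).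
    { apply (qcomputable2_app X (fun _ => n)); auto with comp. }
    assert (HXc : Un_cv (X n) (b - eps n * a)) by (apply CV_minus; [|apply Un_cv_scal]; trivial).
    assert (Hnl : ~ left_ce (b - eps n * a)).
    { intros H; apply Hno; exists (S n + c)%nat; apply left_ce_opp; fold (eps n).
      now replace (- (eps n * a - b)) with (b - eps n * a) by ring. }
    destruct (infinitely_often_above _ _ HXn HXc Hnl O) as [s0 [_ Hs0]].
    destruct (tail_max_attained _ _ O s0 HXc (Nat.le_0_l _) Hs0) as [s [_ [Hs Hmax]]].
    (* From [s] on the running maximum is frozen, so consecutive intervals share an endpoint and
       leave no gap. *)
    assert (HMs : forall u, (s <= u)%nat -> M n u = X n s).
    { intros u Hu; apply Rle_antisym; [apply Hmax; lia|now apply le_argmax]. }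
    assert (Hlim : Un_cv (fun v => X n s + eps n * x v) (X n s + eps n * a))
      by (apply CV_plus; [apply Un_cv_const|now apply Un_cv_scal]).
    destruct (Un_cv_eventually_gt _ _ b Hlim) as [N HN]; [lra|].
    destruct (first_failure (fun v => X n s + eps n * x v <= b) s (N + s)) as [u [Hu [H1 H2]]].
    + unfold X; specialize (Hyb s); lra.
    + specialize (HN (N + s)%nat ltac:(lia)); lra.
    + lia.
    + exists (S u); apply (rsum_indic_ge1 (fun i => Rleb _ b && Rleb b _)%bool).
      specialize (H1 u ltac:(lia)); rewrite (HMs u Hu).
      rewrite !(proj2 (Rleb_true _ _)) by lra; reflexivity.
Qed.

(** The value [O] means that no block is open, and [S h] that [h] is the best index of the current
    block. A block is discarded as soon as [d w <= d (S u)]. *)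
Fixpoint scan (g d : nat -> R) (u m : nat) : nat :=
  match m with
  | O => O
  | S w =>
      if Rleb (d w) (d (S u)) then O
      else if ((1 <=? scan g d u w)%nat && Rleb (g w) (g (pred (scan g d u w))))%bool
      then scan g d u w else S w
  end.

Lemma scan_S (g d : nat -> R) (u w : nat) :
  scan g d u (S w) =
    if Rleb (d w) (d (S u)) then O
    else if ((1 <=? scan g d u w)%nat && Rleb (g w) (g (pred (scan g d u w))))%bool
    then scan g d u w else S w.
Proof. reflexivity. Qed.

(* [peak g d u] maximizes [g] on the longest block [v, u] on which [d] exceeds [d (S u)]. *)
Definition peak (g d : nat -> R) (u : nat) : nat := pred (scan g d u (S u)).

Lemma computable_peak (g d : nat -> R) :
  qcomputable g -> qcomputable d -> computable (peak g d).
Proof.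
  intros Hg Hd; apply computable_pred.
  apply (computable_ext (fun u => nat_rect (fun _ => nat) O (fun w h =>
    if Rleb (d w) (d (S u)) then O
    else if ((1 <=? h)%nat && Rleb (g w) (g (pred h)))%bool then h else S w) (S u))).
  - intros u; generalize (S u) at 2 3; intros m.
    induction m as [|m IH]; [reflexivity|]; rewrite scan_S, <- IH; reflexivity.
  - apply (computable_rec (fun _ => O) S (fun u w h =>
      if Rleb (d w) (d (S u)) then O
      else if ((1 <=? h)%nat && Rleb (g w) (g (pred h)))%bool then h else S w)); auto with comp.
    assert (Hg' : forall f, computable f -> qcomputable (fun x => g (f x)))
      by (intros; now apply qcomputable_comp).
    assert (Hd' : forall f, computable f -> qcomputable (fun x => d (f x)))
      by (intros; now apply qcomputable_comp).
    auto 12 with comp.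
Qed.

(** The block ending at [u] contains [s] but not [t0], where the scan is reset, so it is maximized
    over indices past [t0], among which [s] is best. Only the values of [g] agree: with ties the
    peak may be another index. *)
Lemma peak_spec (g d : nat -> R) (u t0 s : nat) :
  (t0 < s <= u)%nat -> d t0 <= d (S u) ->
  (forall w, (s <= w <= u)%nat -> d (S u) < d w) ->
  (forall w, (t0 < w)%nat -> g w <= g s) ->
  g (peak g d u) = g s.
Proof.
  intros Hs Ht0 Hd Hg.
  assert (H1 : forall m, (t0 < m)%nat -> scan g d u m = O \/ (t0 < pred (scan g d u m))%nat).
  { induction 1 as [|m Hm IH]; rewrite scan_S.
    - rewrite (proj2 (Rleb_true _ _) Ht0); now left.
    - destruct (Rleb _ _); [now left|].
      destruct (_ && _)%bool; [assumption|right; exact Hm]. }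
  assert (H2 : forall m, (s <= m)%nat -> (m <= u)%nat ->
    scan g d u (S m) <> O /\ g (pred (scan g d u (S m))) = g s).
  { induction 1 as [|m Hm IH]; intros Hu; rewrite scan_S.
    - rewrite (proj2 (Rleb_false _ _) (Hd s ltac:(lia))).
      specialize (H1 s ltac:(lia)).
      destruct (scan g d u s) as [|h]; [easy|].
      destruct H1 as [H1|H1]; [discriminate|]; simpl in *.
      destruct (Rleb (g s) (g h)) eqn:E; [|easy].
      apply Rleb_true in E; split; [discriminate|]; simpl; specialize (Hg h H1); lra.
    - destruct IH as [IH1 IH2]; [lia|].
      rewrite (proj2 (Rleb_false _ _) (Hd (S m) ltac:(lia))).
      destruct (scan g d u (S m)) as [|h]; [easy|]; simpl in *.
      destruct (Rleb (g (S m)) (g h)) eqn:E; [easy|].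
      apply Rleb_false in E; specialize (Hg (S m) ltac:(lia)); lra. }
  apply (H2 u); lia.
Qed.

(* If neither real is one-sided c.e., then [g = q a - b] is infinitely often above its limit and
   [d = p a - b] infinitely often below its limit. Let [d] have a minimum at [t0] over a tail, and
   [g] a maximum at [s] over the tail after [t0]. When [d] first drops below
   [g s - (q - p) a], which is above the limit of [d], the interval [(g s - d) / (q - p)] is swept
   across [a]; the test recovers [g s] as the value of [g] at the [peak], since [d] was larger ever
   since [s] but not at [t0]. Each drop of [d] is bounded by the rise of [b], which makes the
   total length finite. *)
Lemma left_or_right_ce (a b : R) (i N : nat) : ML_random a -> left_ce a -> left_ce b ->
  left_ce (INR (S i) / INR (S N) * a - b) \/ right_ce (INR i / INR (S N) * a - b).
Proof.
  intros Hrand Ha Hb; apply NNPP; intros Hno; revert Hrand.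
  apply left_ce_iff in Ha, Hb.
  destruct Ha as [x [Hx [Hxg Hxc]]], Hb as [y [Hy [Hyg Hyc]]].
  assert (Hyb := growing_ineq y b Hyg Hyc).
  set (q := INR (S i) / INR (S N)) in *; set (p := INR i / INR (S N)) in *.
  set (g := fun n => q * x n - y n); set (d := fun n => p * x n - y n).
  assert (Hg : qcomputable g) by (unfold g, q; auto with comp).
  assert (Hd : qcomputable d) by (unfold d, p; auto with comp).
  assert (Hgc : Un_cv g (q * a - b)) by (apply CV_minus; [apply Un_cv_scal|]; assumption).
  assert (Hdc : Un_cv (fun n => - d n) (- (p * a - b)))
    by (apply CV_opp, CV_minus; [apply Un_cv_scal|]; assumption).
  assert (HN : 0 < INR (S N)) by apply lt_0_INR, Nat.lt_0_succ.
  assert (Hp : 0 <= p)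
    by (apply Rmult_le_pos; [apply pos_INR|apply Rlt_le, Rinv_0_lt_compat, HN]).
  (* Consecutive fractions with a common denominator make [1 / (q - p)] the natural number [S N]. *)
  assert (Hqp : INR (S N) * (q - p) = 1) by (unfold q, p; rewrite (S_INR i); field; lra).
  assert (Hg_inf : forall n, exists s, (n <= s)%nat /\ q * a - b < g s)
    by (apply infinitely_often_above; tauto).
  assert (Hd_inf : forall n, exists s, (n <= s)%nat /\ - (p * a - b) < - d s).
  { apply infinitely_often_above; [auto with comp|assumption|].
    intros H; apply Hno; right; now apply left_ce_opp. }
  destruct (exists_pow2_ge (INR (S N) * (b - y O))) as [c Hc].
  set (lo := fun u => INR (S N) * (g (peak g d u) - d u)).
  (* Since [x] increases and [p >= 0], [d u - d (S u)] is at most [y (S u) - y u], so [hi u] is at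
     least the value of [lo] with [d (S u)] in place of [d u]. As [y] is monotone, [lo <= hi] always
     holds and the lengths telescope. *)
  set (hi := fun u => lo u + INR (S N) * (y (S u) - y u)).
  assert (Hlo : qcomputable lo).
  { assert (qcomputable (fun u => g (peak g d u)))
      by (apply qcomputable_comp; [assumption|now apply computable_peak]).
    unfold lo; auto with comp. }
  assert (Hhi : qcomputable hi).
  { assert (qcomputable (fun u => y (S u))) by (apply (qcomputable_comp y); auto with comp).
    unfold hi; auto with comp. }
  (* The intervals are the same for all [n]; only the required number of hits grows. Their total
     length is at most [2 ^ c], which is the threshold times [(/ 2) ^ S n]. *)
  apply (interval_test a (fun _ => lo) (fun _ => hi) (fun n => INR (2 ^ (c + S n)))).
  - apply (qcomputable_comp lo); auto with comp.
  - apply (qcomputable_comp hi); auto with comp.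
  - apply qcomputable_INR, computable_pow2.
    apply (computable_add (fun _ => c)); auto with comp.
  - intros n; change 1 with (INR 1); apply le_INR.
    assert (2 ^ (c + S n) <> 0)%nat by (apply Nat.pow_nonzero; discriminate); lia.
  - intros _ u; unfold hi; specialize (Hyg u).
    assert (0 <= INR (S N) * (y (S u) - y u)) by (apply Rmult_le_pos; lra); lra.
  - intros n K.
    apply Rle_trans with (rsum (fun u => INR (S N) * (y (S u) - y u)) K);
      [apply rsum_le; intros; unfold hi; lra|].
    rewrite rsum_scal, rsum_telescope, pow_INR; change (INR 2) with 2.
    rewrite pow_add, Rmult_assoc, pow2_half_pow, Rmult_1_r.
    specialize (Hyb K); eapply Rle_trans; [|exact Hc].
    apply Rmult_le_compat_l; lra.
  - intros n.
    apply (rsum_indic_unbounded (fun u => Rleb (lo u) a && Rleb a (hi u))%bool).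
    intros n0.
    destruct (Hd_inf n0) as [t [Ht1 Ht2]].
    destruct (tail_max_attained _ _ n0 t Hdc Ht1 Ht2) as [t0 [Hnt0 [_ Hmin]]].
    destruct (Hg_inf (S t0)) as [s1 [Hs1 Hs2]].
    destruct (tail_max_attained _ _ (S t0) s1 Hgc Hs1 Hs2) as [s [Ht0s [Hs Hmax]]].
    set (theta := g s - (q - p) * a).
    assert (Hgd : forall w, g w - d w = (q - p) * x w) by (intros w; unfold g, d; ring).
    assert (Hxa := growing_ineq x a Hxg Hxc).
    assert (Hqp0 : 0 < q - p).
    { apply (Rmult_lt_reg_l (INR (S N))); lra. }
    destruct (Hd_inf s) as [v [Hv1 Hv2]].
    (* [theta <= d w] says that [(g s - d w) / (q - p)] has not passed [a]. At [s] this quotient is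
       [x s <= a], whereas [d v < p * a - b < theta]. *)
    destruct (first_failure (fun w => theta <= d w) s v) as [u [Hu [H1 H2]]].
    + unfold theta; specialize (Hgd s); specialize (Hxa s).
      assert ((q - p) * x s <= (q - p) * a) by (apply Rmult_le_compat_l; lra); lra.
    + unfold theta; lra.
    + assumption.
    + apply Rnot_le_lt in H2; exists u; split; [lia|].
      assert (Hpk : g (peak g d u) = g s).
      { apply (peak_spec g d u t0 s); [lia| | |].
        - specialize (Hmin (S u) ltac:(lia)); lra.
        - intros w Hw; specialize (H1 w Hw); lra.
        - intros w Hw; apply Hmax; lia. }
      specialize (H1 u ltac:(lia)).
      assert (Hlu : lo u <= a).
      { unfold lo; rewrite Hpk; replace a with (INR (S N) * ((q - p) * a))
          by (rewrite <- Rmult_assoc, Hqp; ring).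
        apply Rmult_le_compat_l; unfold theta in *; lra. }
      assert (Hhu : a <= hi u).
      { unfold hi, lo; rewrite Hpk; replace a with (INR (S N) * ((q - p) * a))
          by (rewrite <- Rmult_assoc, Hqp; ring).
        rewrite <- Rmult_plus_distr_l; apply Rmult_le_compat_l; [lra|].
        assert (p * x u <= p * x (S u)) by (apply Rmult_le_compat_l; [assumption|apply Hxg]).
        unfold theta, d in *; lra. }
      now rewrite !(proj2 (Rleb_true _ _)).
Qed.

(** * Comparing the infimum and the supremum *)

Lemma pos_rat_half_pow (k : nat) : pos_rat ((/ 2) ^ k).
Proof.
  split; [apply half_pow_pos|exists 1%nat, (pred (2 ^ k))].
  rewrite Nat.succ_pred_pos by (apply Nat.neq_0_lt_0, Nat.pow_nonzero; discriminate).
  rewrite pow_INR, pow_inv; unfold Rdiv; rewrite Rmult_1_l; reflexivity.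
Qed.

(** The inverse has to rescale a computable sequence, so it is needed as an explicit quotient of
    naturals. *)
Lemma pos_rat_sub_inv (p q : R) : pos_rat p -> pos_rat q -> q < p ->
  exists a b : nat, / (p - q) = INR a / INR (S b).
Proof.
  intros [_ [a [b ->]]] [_ [a' [b' ->]]] H.
  assert (Hb : 0 < INR (S b)) by apply lt_0_INR, Nat.lt_0_succ.
  assert (Hb' : 0 < INR (S b')) by apply lt_0_INR, Nat.lt_0_succ.
  assert (H1 : (a' * S b < a * S b')%nat).
  { apply INR_lt; rewrite !mult_INR; apply (Rmult_lt_compat_r (INR (S b) * INR (S b'))) in H.
    - unfold Rdiv in H; field_simplify in H; lra.
    - now apply Rmult_lt_0_compat. }
  exists (S b * S b')%nat, (pred (a * S b' - a' * S b)).
  rewrite Nat.succ_pred_pos by lia.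
  rewrite minus_INR by lia; apply lt_INR in H1; rewrite !mult_INR in *.
  field; repeat split; lra.
Qed.

Lemma right_le_left (a b p q : R) : ML_random a -> left_ce a -> pos_rat p -> pos_rat q ->
  right_ce (p * a - b) -> left_ce (q * a - b) -> p <= q.
Proof.
  intros Hrand Ha Hp Hq Hr Hl; apply Rnot_lt_le; intros Hlt; revert Hrand.
  apply computable_real_not_random; [assumption|].
  apply right_ce_iff in Hr; apply left_ce_iff in Hl; apply right_ce_iff.
  destruct Hr as [v [Hv [Hvd Hvc]]], Hl as [u [Hu [Hug Huc]]].
  destruct (pos_rat_sub_inv p q Hp Hq Hlt) as [k [l Hkl]].
  assert (Hinv : 0 < / (p - q)) by (apply Rinv_0_lt_compat; lra).
  exists (fun n => / (p - q) * (v n - u n)); repeat split.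
  - rewrite Hkl; auto with comp.
  - intros n; specialize (Hvd n); specialize (Hug n); apply Rmult_le_compat_l; lra.
  - replace a with (/ (p - q) * ((p * a - b) - (q * a - b))) by (field; lra).
    now apply Un_cv_scal, CV_minus.
Qed.

(** The step [1 / (N + 1)] is less than half the gap: the least multiple above [x] is at most one
    step past it, the next at most two. As [0 <= x], that least multiple is nonzero and its index is
    a successor. *)
Lemma consecutive_fractions_between (x y : R) : 0 <= x -> x < y ->
  exists i N : nat, x < INR i / INR (S N) /\ INR (S i) / INR (S N) < y.
Proof.
  intros Hx Hxy.
  destruct (INR_unbounded (2 / (y - x))) as [N HN].
  assert (HN' : INR N < INR (S N)) by apply lt_INR, Nat.lt_succ_diag_r.
  assert (H0 : 0 < INR (S N)) by apply lt_0_INR, Nat.lt_0_succ.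
  assert (H2 : 2 < INR (S N) * (y - x)).
  { apply (Rmult_lt_reg_r (/ (y - x))); [apply Rinv_0_lt_compat; lra|].
    rewrite Rmult_assoc, Rinv_r by lra; unfold Rdiv in HN; lra. }
  destruct (least_nat (fun i => x * INR (S N) < INR i)) as [[|i] [Hi Hmin]].
  { destruct (INR_unbounded (x * INR (S N))) as [i Hi]; exists i; lra. }
  { change (INR 0) with 0 in Hi; assert (0 <= x * INR (S N)) by (apply Rmult_le_pos; lra); lra. }
  specialize (Hmin i (Nat.lt_succ_diag_r i)); apply Rnot_lt_le in Hmin.
  exists (S i), N; rewrite (S_INR (S i)); rewrite (S_INR i) in *.
  split; (apply (Rmult_lt_reg_r (INR (S N))); [assumption|]);
    unfold Rdiv; rewrite Rmult_assoc, Rinv_l by lra; lra.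
Qed.

Theorem theorem1p5 (alpha beta : R) :
  ML_random alpha -> left_ce alpha ->
  ML_random beta -> left_ce beta ->
  Dsolovay alpha beta = Dstar alpha beta.
Proof.
  intros Hra Ha Hrb Hb; unfold Dsolovay, Dstar.
  set (L := fun q => pos_rat q /\ left_ce (q * alpha - beta)).
  set (U := fun q => pos_rat q /\ right_ce (q * alpha - beta)).
  destruct (Glb_Rbar_correct L) as [HL HL'], (Lub_Rbar_correct U) as [HU HU'].
  apply Rbar_le_antisym.
  - apply Rbar_not_lt_le; intros Hlt.
    destruct (random_solovay_complete alpha beta Ha Hb Hrb) as [k Hk].
    assert (HUk := HU _ (conj (pos_rat_half_pow k) Hk)).
    assert (Hk0 := half_pow_pos k).
    (* The member found above makes the supremum nonnegative. The infimum may still be infinite, and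
       then [x + 1] serves as the upper end. *)
    assert (Hxy : exists x y, 0 <= x /\ x < y /\
      Rbar_le (Lub_Rbar U) x /\ Rbar_le y (Glb_Rbar L)).
    { destruct (Lub_Rbar U) as [x| |]; [|contradiction|contradiction].
      simpl in HUk; destruct (Glb_Rbar L) as [y| |]; [| |contradiction].
      - exists x, y; simpl in *; repeat split; lra.
      - exists x, (x + 1); simpl; repeat split; trivial; lra. }
    destruct Hxy as [x [y [Hx [Hxy [Hxu Hyl]]]]].
    destruct (consecutive_fractions_between x y Hx Hxy) as [i [N [Hi1 Hi2]]].
    assert (HiS : INR i / INR (S N) < INR (S i) / INR (S N)).
    { apply Rmult_lt_compat_r; [apply Rinv_0_lt_compat, lt_0_INR, Nat.lt_0_succ|].
      apply lt_INR, Nat.lt_succ_diag_r. }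
    destruct (left_or_right_ce alpha beta i N Hra Ha Hb) as [H|H].
    + assert (HqL : L (INR (S i) / INR (S N))).
      { split; [|assumption]; split; [lra|now exists (S i), N]. }
      specialize (HL _ HqL).
      apply (Rbar_le_trans _ _ _ Hyl) in HL; unfold Rbar_le in HL; lra.
    + assert (HpU : U (INR i / INR (S N))).
      { split; [|assumption]; split; [lra|now exists i, N]. }
      specialize (HU _ HpU).
      apply (fun H1 => Rbar_le_trans _ _ _ H1 Hxu) in HU; unfold Rbar_le in HU; lra.
  - apply HU'; intros p [Hp Hpr]; apply HL'; intros q [Hq Hql]; simpl.
    now apply (right_le_left alpha beta).
Qed.
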